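(* Let $(X,\|\cdot\|)$ be a Banach space, let $b\in[0,\infty)$, $a\in[0,1)$, $\alpha\in(0,1)$, and let $T:X\to X$ be an $(a,b,\alpha)$-enriched interpolative Kannan type operator. Then the fixed point problem of $T$ is well-posed.
   Context: A map $T:X\to X$ on a normed space $(X,\|\cdot\|)$ is called an $(a,b,\alpha)$-enriched interpolative Kannan type operator, where $b\in[0,\infty)$, $a\in[0,1)$ and $\alpha\in(0,1)$, if for all $x,y\in X$ $$\|b(x-y)+(Tx-Ty)\|\le a\,\|x-Tx\|^{\alpha}\,\|y-Ty\|^{1-\alpha}.$$ For a metric space $(X,d)$ and $T:X\to X$, the fixed point problem of $T$ is said to be well-posed if $T$ has a unique fixed point $x^*$ and, for any sequence $\{x_n\}$ in $X$ with $\lim_{n\to\infty}d(Tx_n,x_n)=0$, one has $\lim_{n\to\infty}x_n=x^*$. On a normed space, $d(x,y)=\|x-y\|$. *)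

(* Defs.v *)
From HB Require Import structures.
From mathcomp Require Import all_boot all_order all_algebra.
From mathcomp Require Import all_classical all_reals all_analysis.

Set Implicit Arguments.
Unset Strict Implicit.
Unset Printing Implicit Defensive.

Import Order.TTheory GRing.Theory Num.Theory.
Import numFieldNormedType.Exports.

Local Open Scope classical_set_scope.
Local Open Scope ring_scope.

(* Meant for 0 <= b, 0 <= a < 1 and 0 < alpha < 1.  Both exponents are then
   positive, so that at a fixed point the power [0 `^ _] is 0 and not 1. *)
Definition enriched_interpolative_Kannan (R : realType) (X : normedModType R)
    (a b alpha : R) (T : X -> X) : Prop :=
  forall x y : X,
    `|b *: (x - y) + (T x - T y)|
      <= a * `|x - T x| `^ alpha * `|y - T y| `^ (1 - alpha).

Definition well_posed (R : realType) (X : metricType R) (T : X -> X) : Prop :=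
  exists xstar : X,
    [/\ T xstar = xstar,
        forall y : X, T y = y -> y = xstar &
        forall u : nat -> X,
          mdist (T (u n)) (u n) @[n --> \oo] --> (0 : R) ->
          u n @[n --> \oo] --> xstar].

(* The library does not equip a normed module with its metric d(x, y) = |x - y|.
   The carrier and the topology of [metric_of_norm X] are those of [X]. *)
Section metric_of_norm.
Variables (R : realType) (X : normedModType R).

Let dist (x y : X) : R := `|x - y|.

Let dist_ge0 (x y : X) : 0 <= dist x y.
Proof. exact: normr_ge0. Qed.

Let dist_positivity (x y : X) : dist x y = 0 -> x = y.
Proof. by move=> /normr0_eq0/subr0_eq. Qed.

Let ballEdist (x : X) (e : R) : ball x e = [set y | dist x y < e].
Proof. by rewrite -ball_normE. Qed.

Definition metric_of_norm : metricType R :=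
  HB.pack (X : Type) (PseudoMetric.on X)
    (PseudoMetric_isMetric.Build R X dist_ge0 dist_positivity ballEdist).

End metric_of_norm.

(* Main.v *)
(* The averaged map S = (b id + T) / (b + 1) has the fixed points of T and
   satisfies the inequality with b = 0.  Applied to x and S x, that inequality
   gives |S x - S (S x)| <= a^(1/alpha) |x - S x|, so the displacements along a
   Picard orbit of S tend to 0; applied to two points of the orbit, it then shows
   that the orbit is Cauchy, and its limit is a fixed point.  Conversely, if p
   is a fixed point, the inequality with y = p has right-hand side 0, whence
   T x - x = (b + 1) (p - x) for all x: this gives uniqueness and
   well-posedness at once. *)
Require Import Defs.
From HB Require Import structures.
From mathcomp Require Import all_boot all_order all_algebra.
From mathcomp Require Import all_classical all_reals all_analysis.
Import Order.TTheory GRing.Theory Num.Theory.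
Import numFieldNormedType.Exports.
Local Open Scope classical_set_scope.
Local Open Scope ring_scope.

(** The exponents sum to 1, so [e] splits as [e]^ alpha * e [^ (1 - alpha)] and each factor can be
    compared separately. *)
Lemma powR_interp_le (R : realType) (alpha p q e : R) :
  0 < alpha < 1 -> 0 <= p <= e -> 0 <= q <= e ->
  p `^ alpha * q `^ (1 - alpha) <= e.
Proof.
move=> /andP[al0 al1] /andP[p0 pe] /andP[q0 qe].
have e0 : 0 <= e := le_trans p0 pe.
have -> : e = e `^ alpha * e `^ (1 - alpha).
  by rewrite -powRD (addrC alpha) subrK ?powRr1// oner_eq0.
apply: ler_pM; rewrite ?powR_ge0//.
- by apply: ge0_ler_powR => //; rewrite ?nnegrE// ltW.
- by apply: ge0_ler_powR => //; rewrite ?nnegrE// subr_ge0 ltW.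
Qed.

Lemma powR_interp_self_le (R : realType) (a alpha p q : R) :
  0 < alpha -> 0 <= a -> 0 <= p -> 0 <= q ->
  q <= a * p `^ alpha * q `^ (1 - alpha) -> q <= a `^ alpha^-1 * p.
Proof.
move=> al0 a0 p0; rewrite le_eqVlt => /predU1P[<- _|q0 hq].
  by rewrite mulr_ge0 ?powR_ge0.
have hal : q `^ alpha <= a * p `^ alpha.
  rewrite -(ler_pM2r (powR_gt0 (1 - alpha) q0)) -powRD ?(gt_eqF q0) ?implybT//.
  by rewrite addrC subrK powRr1 ?(ltW q0).
have al_neq0 : alpha != 0 by rewrite gt_eqF.
have powRVK x : 0 <= x -> (x `^ alpha) `^ alpha^-1 = x.
  by move=> x0; rewrite -powRrM divff// powRr1.
rewrite -{1}(powRVK q (ltW q0)) -[X in _ * X](powRVK p p0) -powRM ?powR_ge0//.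
apply: ge0_ler_powR; rewrite ?nnegrE ?powR_ge0 ?mulr_ge0 ?powR_ge0//.
by rewrite invr_ge0 ltW.
Qed.

Lemma interpolative_Kannan_fixpoint (R : realType)
    (X : completeNormedModType R) (a alpha : R) (S : X -> X) :
  0 <= a < 1 -> 0 < alpha < 1 ->
  enriched_interpolative_Kannan a 0 alpha S -> exists p, S p = p.
Proof.
move=> /andP[a0 a1] al01 hS; have /andP[al0 al1] := al01.
have hS0 x y :
    `|S x - S y| <= a * (`|x - S x| `^ alpha * `|y - S y| `^ (1 - alpha)).
  by have := hS x y; rewrite scale0r add0r mulrA.
pose u n := iter n S (0 : X); pose d n := `|u n - S (u n)|.
pose c := a `^ alpha^-1.
have c0 : 0 <= c by exact: powR_ge0.
have c1 : c < 1.
  have -> : 1 = (1 : R) `^ alpha^-1 by rewrite powR1.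
  by apply: gt0_ltr_powR; rewrite ?nnegrE ?invr_gt0.
have dc n : d n <= geometric (d 0%N) c n.
  elim: n => [|n IH]; first by rewrite /= expr0 mulr1.
  have /le_trans : d n.+1 <= c * d n.
    by apply: powR_interp_self_le; rewrite ?normr_ge0// -mulrA; exact: hS0.
  by apply; rewrite /= exprS mulrCA ler_wpM2l.
have d_lt e : 0 < e -> \forall n \near \oo, d n < e.
  move=> e0; have c_lt1 : `|c| < 1 by rewrite ger0_norm.
  near=> n; apply: le_lt_trans (dc n) _; apply: le_lt_trans (ler_norm _) _.
  by near: n; apply: cvgr0_norm_lt e0; exact: cvg_geometric.
have u_cvg : cvg (u n @[n --> \oo]).
  apply: cauchy_cvg; apply: cauchy_exP => e e0.
  have [N _ dN] := d_lt _ (divr_gt0 e0 (ltr0Sn _ 1)).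
  (* Indices shift by one: [u N.+1] and [u n.+1] are the images of [u N] and [u n], so their
     distance is controlled by [d N] and [d n]. *)
  exists (u N.+1); exists N.+1 => // -[//|n] Nn.
  rewrite -ball_normE /ball_ /=.
  apply: le_lt_trans (hS0 (u N) (u n)) _.
  (* The interpolation bound is not strict; halving [e] makes room for the strict inequality. *)
  apply: (@le_lt_trans _ _ (1 * (e / 2))); last first.
    by rewrite mul1r gtr_pMr// invf_lt1// ltr1n.
  apply: ler_pM; rewrite ?mulr_ge0 ?powR_ge0 ?(ltW a1)//.
  apply: powR_interp_le => //; rewrite normr_ge0/= ltW//.
    by apply: (dN N) => /=.
  by apply: (dN n).
set p := lim (u n @[n --> \oo]) in u_cvg.
exists p; apply/eqP; rewrite eq_sym -subr_eq0 -normr_eq0.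
set D := `|p - S p|; apply/negPn/negP => D_neq0.
have D0 : 0 < D by rewrite lt_def D_neq0 normr_ge0.
(* As [d n] tends to 0 and [D > 0], eventually [d n < D]; then [a * D] bounds the distance from
   [u n.+1] to [S p], which tends to [D]. *)
suff : D <= a * D by rewrite leNgt gtr_pMl// a1.
have D_cvg : `|u n.+1 - S p| @[n --> \oo] --> D.
  apply: cvg_norm; apply: cvgB; last exact: cvg_cst.
  by have := u_cvg; rewrite -(cvg_shiftS u).
apply: (cvgr_to_le D_cvg); near=> n.
apply: le_trans (hS0 (u n) p) _; rewrite ler_wpM2l//.
apply: powR_interp_le => //; rewrite normr_ge0//=.
by apply: ltW; near: n; exact: d_lt.
Unshelve. all: by end_near. Qed.

(** Displacements of the average are those of [T] divided by [b + 1]. Since the exponents sum to 1,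
    both sides of the inequality scale by exactly this factor. *)
Lemma enriched_Kannan_average (R : realType) (X : normedModType R)
    (a b alpha : R) (T : X -> X) :
  0 <= b -> 0 < alpha < 1 -> enriched_interpolative_Kannan a b alpha T ->
  enriched_interpolative_Kannan a 0 alpha
    (fun x => (b + 1)^-1 *: (b *: x + T x)).
Proof.
move=> b0 /andP[al0 al1] hT x y.
have l0 : 0 < b + 1 by rewrite ltr_wpDl.
have disp z : z - (b + 1)^-1 *: (b *: z + T z) = (b + 1)^-1 *: (z - T z).
  apply: (scalerI (lt0r_neq0 l0)).
  rewrite scalerBr !scalerA mulfV ?lt0r_neq0// !scale1r scalerDl scale1r.
  by rewrite opprD addrACA subrr add0r.
have v0 : 0 <= (b + 1)^-1 by rewrite invr_ge0 ltW.
rewrite scale0r add0r -scalerBr !disp !normrZ (ger0_norm v0) !powRM//.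
have -> : b *: x + T x - (b *: y + T y) = b *: (x - y) + (T x - T y).
  by rewrite scalerBr opprD addrACA.
have lE : (b + 1)^-1 `^ alpha * (b + 1)^-1 `^ (1 - alpha) = (b + 1)^-1.
  by rewrite -powRD (addrC alpha) subrK ?powRr1// oner_eq0.
rewrite mulrACA !mulrA (mulrAC a) -(mulrA a) lE.
by rewrite (mulrC a) -!mulrA ler_wpM2l// mulrA; exact: hT.
Qed.

Lemma enriched_Kannan_affine (R : realType) (X : normedModType R)
    (a b alpha : R) (T : X -> X) (p : X) :
  alpha < 1 -> enriched_interpolative_Kannan a b alpha T -> T p = p ->
  forall x, T x - x = (b + 1) *: (p - x).
Proof.
move=> al1 hT Tp x; have := hT x p.
(* The exponent [1 - alpha] is nonzero, so the power of 0 vanishes and the norm on the left is 0. *)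
rewrite Tp subrr normr0 powR0 ?mulr0; last by rewrite subr_eq0 gt_eqF.
rewrite normr_le0 => /eqP E; apply/eqP; rewrite -subr_eq0 -E; apply/eqP.
rewrite scalerDl scale1r -(opprB x p) scalerN opprD opprK addrCA.
by rewrite opprK [T x - x + _]addrA subrK.
Qed.

Theorem theorem3p1p2 (R : realType) (X : completeNormedModType R)
    (a b alpha : R) (hb : 0 <= b) (ha : 0 <= a < 1) (halpha : 0 < alpha < 1)
    (T : X -> X) (hT : enriched_interpolative_Kannan a b alpha T) :
  @well_posed R (metric_of_norm X) T.
Proof.
have l0 : b + 1 != 0 by rewrite lt0r_neq0// ltr_wpDl.
have [p Sp] := interpolative_Kannan_fixpoint _ _ _ _ _ ha halpha
  (enriched_Kannan_average _ _ _ _ _ _ hb halpha hT).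
have Tp : T p = p.
  (* Multiplied by [b + 1], the equation [Sp] reads [b *: p + T p = b *: p + p]. *)
  have := congr1 ( *:%R (b + 1)) Sp.
  by rewrite scalerA mulfV// scale1r scalerDl scale1r => /addrI.
have /andP[_ al1] := halpha.
have TE := enriched_Kannan_affine _ _ _ _ _ _ _ al1 hT Tp.
exists p; split => // [y Ty|u].
  have /esym/eqP := TE y; rewrite Ty subrr scaler_eq0 (negPf l0)/= subr_eq0.
  by move=> /eqP.
rewrite (_ : (fun n => mdist _ _) = (fun n => `|T (u n) - u n|))//.
move=> /cvgr0Pnorm_lt hu; apply/(@cvgrPdist_lt R X) => e e0.
have lp : 0 < b + 1 by rewrite ltr_wpDl.
(* By [TE], [b + 1] times the distance from [u n] to [p] is the displacement of [u n], so the
   threshold is [(b + 1) * e]. *)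
near=> n; rewrite -(ltr_pM2l lp) -{1}(gtr0_norm lp) -normrZ -TE -normr_id.
by near: n; apply: hu; rewrite mulr_gt0.
Unshelve. all: by end_near. Qed.
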